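(* For all $z\in\mathcal{D}$ and $n\in\mathbb{Z}_+$, $$B_\alpha\bigl(U_n(z)\bigr)=-\omega_n+B_\alpha(z)\qquad\text{and}\qquad B_{-\alpha}\bigl(U_n(z)\bigr)=\omega_n+B_{-\alpha}(z).$$
   Context: $\mathcal{D}$ is the open unit disk in $\mathbb{C}$ centered at $0$, $\overline{\mathcal{D}}$ its closure, $\partial\mathcal{D}$ the unit circle. Fix $\alpha\in\partial\mathcal{D}$. For $x\in(-1,1)$ let $q_{x,\alpha}(z)=\frac{z+x\alpha}{1+x\bar\alpha z}$ for $z\in\overline{\mathcal{D}}$. For $\gamma\in\mathbb{R}$ let $g_\gamma:=q_{x,\alpha}$ where $x\in(-1,1)$ is determined by $\gamma=\log\frac{1+x}{1-x}$. Let $(x_n)_{n\in\mathbb{N}}$ be a stationary and ergodic sequence of random variables with values in $(-1,1)$; put $\gamma_n=\log\frac{1+x_n}{1-x_n}$, $\omega_0=0$, $\omega_n=\sum_{i=1}^n\gamma_i$, and $U_n:=g_{\omega_n}$ for $n\in\mathbb{Z}_+=\mathbb{N}\cup\{0\}$. The claim holds for every realization of the sequence. For $\xi\in\partial\mathcal{D}$ the Busemann function is $B_\xi(z)=-\log\Bigl(\frac{1-|z|^2}{|\xi-z|^2}\Bigr)$, $z\in\mathcal{D}$. *)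

(* Defs.v *)
From HB Require Import structures.
From mathcomp Require Import all_boot all_order all_algebra.
From mathcomp Require Import all_classical all_reals all_analysis.
From mathcomp Require Export complex.
From mathcomp Require Import ring lra.

Set Implicit Arguments.
Unset Strict Implicit.
Unset Printing Implicit Defensive.

Import Order.TTheory GRing.Theory Num.Theory.
Local Open Scope classical_set_scope.
Local Open Scope ring_scope.
Local Open Scope complex_scope.

(* [normc] is the modulus with values in R; the norm [`|z|] on R[i] takes its
   values in R[i]. *)
Definition normc {R : realType} (z : R[i]) : R := ComplexField.Normc.normc z.

Definition unit_disk {R : realType} : set R[i] := [set z | normc z < 1].

Definition unit_circle {R : realType} : set R[i] := [set z | normc z = 1].

Definition disk_map {R : realType} (x : R) (alpha z : R[i]) : R[i] :=
  (z + x%:C * alpha) / (1 + x%:C * alpha^* * z).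

Definition log_ratio {R : realType} (x : R) : R := ln ((1 + x) / (1 - x)).

(* The x in (-1, 1) determined by gamma = log ((1 + x) / (1 - x)); the default
   value 0 of [xget] is irrelevant, by the lemma that follows. *)
Definition log_ratio_inv {R : realType} (gamma : R) : R :=
  xget 0 [set x : R | -1 < x < 1 /\ gamma = log_ratio x].

Lemma log_ratio_bij (R : realType) (gamma : R) :
  exists! x : R, -1 < x < 1 /\ gamma = log_ratio x.
Proof.
have e0 := expR_gt0 gamma; set e := expR gamma in e0.
have e1 : e + 1 != 0 by apply: lt0r_neq0; lra.
have hx : 1 - (e - 1) / (e + 1) = 2 / (e + 1) by field.
have hx' : 1 + (e - 1) / (e + 1) = 2 * e / (e + 1) by field.
have p1 : 0 < 2 / (e + 1) by apply: divr_gt0; lra.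
have p2 : 0 < 2 * e / (e + 1) by apply: divr_gt0; lra.
exists ((e - 1) / (e + 1)); split.
  split; first by apply/andP; split; lra.
  rewrite /log_ratio hx hx'.
  have -> : 2 * e / (e + 1) / (2 / (e + 1)) = e by field.
  by rewrite expRK.
move=> x [/andP[x1 x2] E].
have y0 : 1 - x != 0 by apply: lt0r_neq0; lra.
have : e = (1 + x) / (1 - x).
  by rewrite /e E lnK // posrE; apply: divr_gt0; lra.
move=> ee; apply: (mulIf e1); rewrite divfK //.
have : e * (1 - x) = 1 + x by rewrite ee divfK.
lra.
Qed.

Definition hyp_translation {R : realType} (alpha : R[i]) (gamma : R) :
  R[i] -> R[i] := disk_map (log_ratio_inv gamma) alpha.

Definition busemann {R : realType} (xi z : R[i]) : R :=
  - ln ((1 - normc z ^+ 2) / normc (xi - z) ^+ 2).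

Section sequences.
Context d (T : measurableType d) (R : realType) (P : probability T R).

Definition seq_shift (u : nat -> R) : nat -> R := fun n => u n.+1.

(* The product sigma-algebra on the space of real sequences. *)
Definition seq_measurable : set (set (nat -> R)) :=
  <<s [set A | exists n, exists2 B : set R, measurable B &
                 A = [set u | B (u n)]] >>.

(* Processes are indexed from 0: [x n] is the (n+1)-st variable of the
   sequence x_1, x_2, ... *)
Definition trajectory (x : nat -> {RV P >-> R}) (t : T) : nat -> R :=
  fun n => x n t.

Definition stationary (x : nat -> {RV P >-> R}) : Prop :=
  forall A, seq_measurable A ->
    P [set t | A (seq_shift (trajectory x t))] = P [set t | A (trajectory x t)].

(* Every shift-invariant event of the path space is trivial for the law of x. *)
Definition ergodic (x : nat -> {RV P >-> R}) : Prop :=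
  forall A, seq_measurable A -> seq_shift @^-1` A = A ->
    P [set t | A (trajectory x t)] = 0%E \/ P [set t | A (trajectory x t)] = 1%E.

Definition omega (x : nat -> {RV P >-> R}) (n : nat) (t : T) : R :=
  \sum_(i < n) log_ratio (x i t).

Definition U (alpha : R[i]) (x : nat -> {RV P >-> R}) (n : nat) (t : T) :
  R[i] -> R[i] := hyp_translation alpha (omega x n t).

End sequences.

(* Main.v *)
(* Put D = 1 + x conj(alpha) z and w = disk_map x alpha z, with |alpha| = 1.
   Then alpha - w = (1 - x) (alpha - z) / D and
   1 - |w|^2 = (1 - x^2) (1 - |z|^2) / |D|^2, so the Poisson kernel at alpha is
   multiplied by (1 + x) / (1 - x).  The statement at - alpha is the same one,
   since disk_map x alpha = disk_map (- x) (- alpha). *)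
Require Import Defs.
From mathcomp Require Import all_boot all_order all_algebra.
From mathcomp Require Import all_classical all_reals all_analysis.
From mathcomp Require Import complex.
From mathcomp Require Import ring lra.

Import Order.TTheory GRing.Theory Num.Theory.
Local Open Scope classical_set_scope.
Local Open Scope ring_scope.

Lemma sqr_normcE (R : realType) (z : R[i]) :
  normc z ^+ 2 = complex.Re z ^+ 2 + complex.Im z ^+ 2.
Proof.
by case: z => a b; rewrite /normc /= sqr_sqrtr // addr_ge0 ?sqr_ge0.
Qed.

Lemma normc_ge0 (R : realType) (z : R[i]) : 0 <= normc z.
Proof. by case: z => a b; apply: sqrtr_ge0. Qed.

(** Both squared moduli expand with the same cross term 2 x Re(conj(alpha) z), and |alpha| = 1
    reduces the rest to 1 + x^2 |z|^2 and |z|^2 + x^2. The division-free form needs no nonzero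
    denominator, so it can serve to prove that the denominator is nonzero. *)
Lemma sqr_normc_disk_map_denom (R : realType) (x : R) (alpha z : R[i]) :
  normc alpha = 1 ->
  normc (1 + x%:C * alpha^* * z)%C ^+ 2 =
    normc (z + x%:C * alpha)%C ^+ 2 + (1 - x ^+ 2) * (1 - normc z ^+ 2).
Proof.
move=> /(congr1 (fun r => r ^+ 2)); rewrite !sqr_normcE.
by case: alpha z => c e [a b] /=; nra.
Qed.

(** After clearing the denominator, alpha * conj(alpha) = 1 turns the left side into alpha + x z - z
    - x alpha, which factors. *)
Lemma sub_disk_map (R : realType) (x : R) (alpha z : R[i]) :
  normc alpha = 1 -> (1 + x%:C * alpha^* * z)%C != 0 ->
  alpha - disk_map x alpha z =
    ((1 - x)%:C * (alpha - z) / (1 + x%:C * alpha^* * z))%C.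
Proof.
move=> alpha1 D0.
have alpha_conj : (alpha * alpha^*)%C = 1.
  move: alpha1 => /(congr1 (fun r => r ^+ 2)); rewrite sqr_normcE.
  case: {D0} alpha => c e /= ce; apply/eqP; rewrite eq_complex /=.
  by apply/andP; split; apply/eqP; lra.
apply: (mulIf D0); rewrite mulrBl /disk_map !divfK // mulrDr mulr1.
rewrite mulrA (mulrCA alpha) alpha_conj mulr1 rmorphB rmorph1 /=; ring.
Qed.

Lemma busemann_disk_map (R : realType) (x : R) (alpha z : R[i]) :
  normc alpha = 1 -> -1 < x < 1 -> normc z < 1 ->
  busemann alpha (disk_map x alpha z) = - log_ratio x + busemann alpha z.
Proof.
move=> alpha1 /andP[x_gt x_lt] z1.
have z_gt0 : 0 < 1 - normc z ^+ 2.
  by rewrite subr_gt0 expr_lt1 // normc_ge0.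
have x_gt0 : 0 < 1 - x ^+ 2 by nra.
have := sqr_normc_disk_map_denom _ x _ z alpha1.
set D := (1 + _)%C; set N := (z + _)%C => DE.
(* By [DE] this is a square plus a product of two positive factors. *)
have D_gt0 : 0 < normc D ^+ 2.
  by rewrite DE ltr_wpDl ?sqr_ge0 // mulr_gt0.
have D0 : D != 0.
  apply: contraTneq D_gt0 => ->.
  by rewrite /normc ComplexField.Normc.normc0 expr0n ltxx.
(* Equality alpha = z would force |z| = 1. *)
have az_gt0 : 0 < normc (alpha - z) ^+ 2.
  rewrite exprn_gt0 // lt_def normc_ge0 andbT.
  apply: contraTneq z1 => /ComplexField.Normc.eq0_normc/subr0_eq <-.
  by rewrite alpha1 ltxx.
have norm_w : normc (disk_map x alpha z) ^+ 2 = normc N ^+ 2 / normc D ^+ 2.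
  by rewrite /disk_map /normc ComplexField.Normc.normcM
    ComplexField.Normc.normcV exprMn exprVn.
have norm_aw : normc (alpha - disk_map x alpha z) ^+ 2 =
    (1 - x) ^+ 2 * normc (alpha - z) ^+ 2 / normc D ^+ 2.
  rewrite sub_disk_map // /normc !ComplexField.Normc.normcM
    ComplexField.Normc.normcV !exprMn exprVn; congr (_ * _ / _).
  by rewrite -/(normc _) sqr_normcE /= expr0n addr0.
(* Both arguments of [ln] are positive, so the logarithms merge and it remains to compare their
   arguments. *)
rewrite /busemann /log_ratio -opprD -lnM ?posrE ?divr_gt0 //; try lra.
congr (- ln _); rewrite norm_w norm_aw.
(* Eliminating |N|^2 leaves an identity of rational functions. *)
have -> : normc N ^+ 2 = normc D ^+ 2 - (1 - x ^+ 2) * (1 - normc z ^+ 2).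
  by rewrite DE; ring.
move: (lt0r_neq0 D_gt0) (lt0r_neq0 az_gt0).
set p := normc D ^+ 2; set q := normc (alpha - z) ^+ 2 => p0 q0.
by field; rewrite p0 q0 andbT; apply: lt0r_neq0; lra.
Qed.

Lemma log_ratio_invP (R : realType) (gamma : R) :
  -1 < log_ratio_inv gamma < 1 /\ gamma = log_ratio (log_ratio_inv gamma).
Proof.
have [x [xP _]] := log_ratio_bij gamma.
exact: (@xgetPex _ 0 [set y : R | -1 < y < 1 /\ gamma = log_ratio y]
  (ex_intro _ x xP)).
Qed.

Lemma log_ratioN (R : realType) (x : R) :
  -1 < x < 1 -> log_ratio (- x) = - log_ratio x.
Proof.
move=> /andP[x_gt x_lt]; rewrite /log_ratio opprK -lnV ?invf_div //.
by rewrite posrE divr_gt0 //; lra.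
Qed.

Lemma disk_mapN (R : realType) (x : R) (alpha z : R[i]) :
  disk_map (- x) (- alpha) z = disk_map x alpha z.
Proof. by rewrite /disk_map !rmorphN /= !mulrNN. Qed.

Theorem proposition7 (d : measure_display) (T : measurableType d)
    (R : realType) (P : probability T R)
    (alpha : R[i]) (x : nat -> {RV P >-> R}) :
  unit_circle alpha ->
  (forall n t, -1 < x n t < 1) ->
  stationary x ->
  ergodic x ->
  forall (t : T) (z : R[i]) (n : nat), unit_disk z ->
    busemann alpha (U alpha x n t z) = - omega x n t + busemann alpha z /\
    busemann (- alpha) (U alpha x n t z) = omega x n t + busemann (- alpha) z.
Proof.
move=> alpha1 _ _ _ t z n z1; rewrite /U /hyp_translation.
have [] := log_ratio_invP _ (omega x n t).
(* Folding the parameter into [y] first keeps the rewriting of [omega x n t] out of the disk map. *)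
set y := log_ratio_inv _ => y1 ->; split; first exact: busemann_disk_map.
rewrite -disk_mapN busemann_disk_map ?log_ratioN ?opprK //.
- by rewrite /normc normcN.
- by rewrite ltrN2 ltrNl andbC.
Qed.
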